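(* Let $(\mathcal{R},\oplus,+)$ be a commutative perfect cancellative Banach semi-ring of characteristic $1$ with fixed element $E$ and semi-field of fractions $\mathcal{F}$, and assume moreover that $\mathcal{R}=\{X\in\mathcal{F}: 0\le X\}$. Then: 1. $\mathcal{F}$ is a Banach semi-field with respect to the distance $(X,Y)\mapsto r(X-Y)$. 2. The map $$\Theta:(\mathcal{R},\oplus,+)\to(C^0(S_E(\mathcal{F}),[0,+\infty[),\max(\,,),+),\qquad X\mapsto\Theta_X,\quad\Theta_X(\phi)=\phi(X),$$ is an isometric isomorphism of semi-rings, and $$\forall X\in\mathcal{R},\quad r(X)=\sup_{\phi\in S_E(\mathcal{R})}|\Theta_X(\phi)|.$$
   Context: A commutative semi-ring of characteristic $1$ is a triple $(\mathcal{R},\oplus,+)$ with two associative laws such that: $(\mathcal{R},+)$ is an abelian monoid with identity $0$; $\oplus$ is commutative with $X\oplus X=X$ for all $X$; and $X+(Y\oplus Z)=(X+Y)\oplus(X+Z)$ for all $X,Y,Z$. It is cancellative if $X+Y=X+Z$ implies $Y=Z$, and perfect if for every integer $n\ge1$ the map $X\mapsto nX$ is surjective (in the cancellative case it is then bijective, which defines an action $(t,X)\mapsto tX$ of the positive rationals). Partial order: $X\le Y$ iff $X\oplus Y=Y$. A cancellative $\mathcal{R}$ embeds canonically in its semi-field of fractions $\mathcal{F}=\{X-Y: X,Y\in\mathcal{R}\}$, where $(\mathcal F,+)$ is the group of differences, $(A-B)\oplus(A'-B')=\bigl((A+B')\oplus(A'+B)\bigr)-(B+B')$, and the order is defined by the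 same rule. Standing assumptions: (i) there is a fixed $E\in\mathcal{R}$ such that for every $X\in\mathcal{R}$ there is $t\in\mathbb{Q}^+$ with $-tE\le X\le tE$ (inequalities in $\mathcal{F}$); the same then holds for every $X\in\mathcal{F}$; (ii) for $Z\in\mathcal{F}$ set $r(Z)=\inf\{t\in\mathbb{Q}^+: -tE\le Z\le tE\}$; then $r(Z)=0$ implies $Z=0$. $\mathcal{R}$ (resp. $\mathcal{F}$) is Banach if it is complete for the distance $r(X-Y)$. $S_E(\mathcal{F})$ (resp. $S_E(\mathcal{R})$) is the set of maps $\phi$ from $\mathcal{F}$ (resp. $\mathcal{R}$) to $\mathbb{R}$ with $\phi(X\oplus Y)=\max(\phi(X),\phi(Y))$, $\phi(X+Y)=\phi(X)+\phi(Y)$ and $\phi(E)=1$, endowed with the weakest topology making all evaluations $\phi\mapsto\phi(X)$ continuous; restriction to $\mathcal{R}$ is a homeomorphism $S_E(\mathcal{F})\to S_E(\mathcal{R})$, by which the two are identified. Isometric means for the distance $r(X-Y)$ and the supremum distance. *)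

(* Defs.v *)
From HB Require Import structures.
From mathcomp Require Import all_boot all_order all_algebra.
From mathcomp Require Import all_classical all_reals all_analysis.

Set Implicit Arguments.
Unset Strict Implicit.
Unset Printing Implicit Defensive.

Import Order.TTheory GRing.Theory Num.Theory.
Import numFieldNormedType.Exports.

Local Open Scope classical_set_scope.
Local Open Scope ring_scope.
Local Open Scope quotient_scope.

Reserved Notation "x ⊕ y" (at level 50, left associativity).
Reserved Notation "x ≼ y" (at level 70, no associativity).

(* The abelian monoid [(R, +, 0)] is the [nmodType] structure; [nX] is
   [X *+ n]. *)
HB.mixin Record Nmodule_isChar1 R of GRing.Nmodule R := {
  oplus : R -> R -> R;
  oplusA : associative oplus;
  oplusC : commutative oplus;
  oplusxx : idempotent_op oplus;
  add_oplusr : right_distributive (@GRing.add R) oplus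
}.

#[short(type="char1SemiRingType")]
HB.structure Definition Char1SemiRing :=
  {R of GRing.Nmodule R & Nmodule_isChar1 R}.

HB.mixin Record Nmodule_isCancellative R of GRing.Nmodule R := {
  add_cancel : forall X Y Z : R, X + Y = X + Z -> Y = Z
}.

#[short(type="cancelChar1SemiRingType")]
HB.structure Definition CancelChar1SemiRing :=
  {R of Char1SemiRing R & Nmodule_isCancellative R}.

(* A semi-field of characteristic 1 is a semi-ring of characteristic 1 whose
   monoid [(F, +)] is a group. *)
#[short(type="char1SemiFieldType")]
HB.structure Definition Char1SemiField :=
  {F of Char1SemiRing F & GRing.Zmodule F}.

Notation "x ⊕ y" := (oplus x y) : ring_scope.

Definition char1_le (R : char1SemiRingType) (X Y : R) : Prop := X ⊕ Y = Y.

Notation "x ≼ y" := (char1_le x y) : ring_scope.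

Definition perfect (R : nmodType) : Prop :=
  forall n : nat, (1 <= n)%N -> forall Y : R, exists X : R, X *+ n = Y.

(* For [t = p / q > 0], [rat_act t X] is the element [Y] with [q Y = p X]. It
   exists and is unique in a perfect cancellative semi-ring of characteristic
   1; otherwise the value is arbitrary. *)
Definition rat_act (R : nmodType) (t : rat) (X : R) : R :=
  xget 0 [set Y : R | Y *+ `|denq t|%N = X *+ `|numq t|%N].

Module SemiFrac.
Section SemiFrac.
Variable R : cancelChar1SemiRingType.
Implicit Types x y z : R * R.

Definition equivf x y := x.1 + y.2 == y.1 + x.2.

Lemma equivf_refl : reflexive equivf.
Proof. by move=> x; rewrite /equivf. Qed.

Lemma equivf_sym : symmetric equivf.
Proof. by move=> x y; rewrite /equivf eq_sym. Qed.

Lemma equivf_trans : transitive equivf.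
Proof.
move=> y x z /eqP xy /eqP yz; apply/eqP/(@add_cancel _ y.2).
by rewrite addrA [y.2 + _]addrC xy addrAC yz addrAC addrC.
Qed.

Canonical equivf_equiv := EquivRel equivf equivf_refl equivf_sym equivf_trans.

(* The class of [(A, B)] is the difference [A - B]. *)
Definition type := {eq_quot equivf}.

#[export] HB.instance Definition _ : EqQuotient _ equivf type := EqQuotient.on type.
#[export] HB.instance Definition _ := Choice.on type.

Lemma piE x y : (\pi_type x = \pi_type y) <-> (x.1 + y.2 = y.1 + x.2).
Proof.
split=> [/eqP|/eqP xy]; first by rewrite eqmodE => /eqP.
by apply/eqP; rewrite eqmodE.
Qed.

Lemma reprE x : (repr (\pi_type x)).1 + x.2 = x.1 + (repr (\pi_type x)).2.
Proof. by apply/piE; rewrite reprK. Qed.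

Definition zero : type := \pi_type (0, 0).

Definition add (a b : type) : type :=
  \pi_type ((repr a).1 + (repr b).1, (repr a).2 + (repr b).2).

Definition opp (a : type) : type := \pi_type ((repr a).2, (repr a).1).

Definition join (a b : type) : type :=
  \pi_type (((repr a).1 + (repr b).2) ⊕ ((repr b).1 + (repr a).2),
       (repr a).2 + (repr b).2).

Lemma addE x y : add (\pi_type x) (\pi_type y) = \pi_type (x.1 + y.1, x.2 + y.2).
Proof.
by apply/piE => /=; rewrite addrACA !reprE addrACA.
Qed.

Lemma oppE x : opp (\pi_type x) = \pi_type (x.2, x.1).
Proof. by apply/piE => /=; rewrite addrC -reprE addrC. Qed.

Let add_oplusl (X Y Z : R) : (X ⊕ Y) + Z = (X + Z) ⊕ (Y + Z).
Proof. by rewrite addrC add_oplusr ![Z + _]addrC. Qed.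

Lemma joinE x y : join (\pi_type x) (\pi_type y) =
  \pi_type ((x.1 + y.2) ⊕ (y.1 + x.2), x.2 + y.2).
Proof.
apply/piE => /=; rewrite !add_oplusl; congr (_ ⊕ _).
  by rewrite addrACA reprE [RHS]addrACA [y.2 + _]addrC.
rewrite [x.2 + y.2]addrC addrACA reprE [X in _ = _ + X]addrC [RHS]addrACA.
by rewrite [x.2 + _]addrC.
Qed.

Lemma quotP (P : type -> Prop) : (forall x, P (\pi_type x)) -> forall a, P a.
Proof. by move=> H a; rewrite -[a]reprK. Qed.

Lemma addA : associative add.
Proof.
elim/quotP=> x; elim/quotP=> y; elim/quotP=> z.
by rewrite !addE /= !addrA.
Qed.

Lemma addC : commutative add.
Proof.
elim/quotP=> x; elim/quotP=> y.
by rewrite !addE addrC [x.2 + _]addrC.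
Qed.

Lemma add0 : left_id zero add.
Proof. by elim/quotP=> -[x y]; rewrite addE /= !add0r. Qed.

Lemma addN : left_inverse zero opp add.
Proof.
elim/quotP=> -[x y]; rewrite oppE addE /=.
by apply/piE; rewrite /= addr0 add0r addrC.
Qed.

#[export] HB.instance Definition _ := GRing.isZmodule.Build type addA addC add0 addN.

Lemma joinA : associative join.
Proof.
elim/quotP=> x; elim/quotP=> y; elim/quotP=> z.
rewrite !joinE /= !add_oplusl oplusA addrA.
rewrite [y.1 + z.2 + x.2]addrAC -[z.1 + y.2 + x.2]addrA [y.2 + x.2]addrC.
by rewrite !addrA.
Qed.

Lemma joinC : commutative join.
Proof.
elim/quotP=> x; elim/quotP=> y.
by rewrite !joinE oplusC [x.2 + _]addrC.
Qed.

Lemma joinxx : idempotent_op join.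
Proof.
elim/quotP=> x; rewrite /= joinE oplusxx.
by apply/piE; rewrite /= addrA.
Qed.

Lemma add_joinr : right_distributive add join.
Proof.
elim/quotP=> x; elim/quotP=> y; elim/quotP=> z.
rewrite !(joinE, addE) /=; apply/piE => /=.
rewrite add_oplusr !add_oplusl.
by congr (_ ⊕ _); rewrite !addrA [LHS](ACl (1*2*4*3*6*5*7)).
Qed.

#[export] HB.instance Definition _ :=
  Nmodule_isChar1.Build type joinA joinC joinxx add_joinr.

End SemiFrac.
Module Exports.
HB.reexport.
End Exports.
End SemiFrac.
Export SemiFrac.Exports.

Notation semifrac := SemiFrac.type.

Definition to_semifrac (R : cancelChar1SemiRingType) (X : R) : semifrac R :=
  \pi_(semifrac R) (X, 0 : R).

Section Radius.
Variables (K : realType) (R : cancelChar1SemiRingType) (E : R).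

Definition bounded_by (t : rat) (Z : semifrac R) : Prop :=
  - to_semifrac (rat_act t E) ≼ Z /\ Z ≼ to_semifrac (rat_act t E).

Definition order_unit : Prop :=
  forall X : R, exists t : rat, 0 < t /\ bounded_by t (to_semifrac X).

Definition unit_radius (Z : semifrac R) : K :=
  inf [set (ratr t : K) | t in [set t : rat | 0 < t /\ bounded_by t Z]].

Definition semifrac_dist (X Y : semifrac R) : K := unit_radius (X - Y).

Definition semiring_dist (X Y : R) : K :=
  semifrac_dist (to_semifrac X) (to_semifrac Y).

End Radius.

Section Complete.
Variables (K : realType) (T : Type) (d : T -> T -> K).

Definition is_distance : Prop :=
  [/\ forall x y, 0 <= d x y,
      forall x y, d x y = 0 <-> x = y,
      forall x y, d x y = d y x &
      forall x y z, d x z <= d x y + d y z].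

Definition cauchy_seq (u : nat -> T) : Prop :=
  forall e : K, 0 < e ->
  exists N : nat, forall m n : nat, (N <= m)%N -> (N <= n)%N ->
    d (u m) (u n) < e.

Definition complete_dist : Prop :=
  forall u : nat -> T, cauchy_seq u ->
  exists l : T, d (u n) l @[n --> \oo] --> (0 : K).

End Complete.

Definition banach (K : realType) (R : char1SemiRingType) (d : R -> R -> K)
  : Prop := is_distance d /\ complete_dist d.

Definition banach_semifield (K : realType) (F : char1SemiFieldType)
  (d : F -> F -> K) : Prop := banach d.

Record spectrum (K : realType) (R : char1SemiRingType) (E : R) := Spectrum {
  char_fun :> R -> K;
  char_oplus : forall X Y : R,
    char_fun (X ⊕ Y) = Num.max (char_fun X) (char_fun Y);
  char_add : forall X Y : R, char_fun (X + Y) = char_fun X + char_fun Y;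
  char_unit : char_fun E = 1
}.

Section SpectrumTopology.
Variables (K : realType) (R : char1SemiRingType) (E : R).
Local Notation S := (spectrum K E).

HB.instance Definition _ := gen_eqMixin S.
HB.instance Definition _ := gen_choiceMixin S.

Definition evaluation (X : R) (phi : S) : K := phi X.

(* The supremum, over [X], of the initial topologies of the evaluations at
   [X]. *)
HB.instance Definition _ := Topological.copy S
  (sup_topology (fun X : R =>
     Topological.class (initial_topology (evaluation X)))).

Lemma evaluation_continuous (X : R) : continuous (evaluation X).
Proof.
move=> phi; apply: (@cvg_trans _ (evaluation X @ nbhs
  (phi : initial_topology (evaluation X)))).
  apply: cvg_app.
  by have /cvg_sup/(_ X) : nbhs phi --> phi by exact: cvg_id.
exact: initial_continuous.
Qed.

End SpectrumTopology.

(* [C^0(S, [0, +oo[)]: continuity into the subspace [[0, +oo[] of [K] is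
   continuity into [K]. *)
Record C0nonneg (S : topologicalType) (K : realType) := MkC0nonneg {
  C0fun :> S -> K;
  C0_continuous : continuous C0fun;
  C0_ge0 : forall s, 0 <= C0fun s
}.

Section C0SemiRing.
Variables (S : topologicalType) (K : realType).
Local Notation C := (C0nonneg S K).
Implicit Types f g h : C.

HB.instance Definition _ := gen_eqMixin C.
HB.instance Definition _ := gen_choiceMixin C.

Lemma C0P f g : (forall s, f s = g s) -> f = g.
Proof.
case: f g => [f fc f0] [g gc g0] /= /funext fg.
by case: _ / fg in gc g0 *; congr MkC0nonneg; exact: Prop_irrelevance.
Qed.

Lemma C0zero_continuous : continuous (fun _ : S => 0 : K).
Proof. by move=> s; exact: cvg_cst. Qed.

Definition C0zero : C := MkC0nonneg C0zero_continuous (fun _ => lexx 0).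

Lemma C0add_continuous f g : continuous (fun s => f s + g s).
Proof. by move=> s; apply: cvgD; exact: C0_continuous. Qed.

Definition C0add f g : C :=
  MkC0nonneg (@C0add_continuous f g)
    (fun s => addr_ge0 (C0_ge0 f s) (C0_ge0 g s)).

Lemma C0max_continuous f g : continuous (fun s => Num.max (f s) (g s)).
Proof.
by move=> s; apply: (@continuous_max K S f g); exact: C0_continuous.
Qed.

Lemma C0max_ge0 f g s : 0 <= Num.max (f s) (g s).
Proof. by rewrite le_max C0_ge0. Qed.

Definition C0max f g : C := MkC0nonneg (@C0max_continuous f g) (@C0max_ge0 f g).

Lemma C0addA : associative C0add.
Proof. by move=> f g h; apply: C0P => s; exact: addrA. Qed.

Lemma C0addC : commutative C0add.
Proof. by move=> f g; apply: C0P => s; exact: addrC. Qed.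

Lemma C0add0 : left_id C0zero C0add.
Proof. by move=> f; apply: C0P => s; exact: add0r. Qed.

HB.instance Definition _ := GRing.isNmodule.Build C C0addA C0addC C0add0.

Lemma C0maxA : associative C0max.
Proof. by move=> f g h; apply: C0P => s; exact: maxA. Qed.

Lemma C0maxC : commutative C0max.
Proof. by move=> f g; apply: C0P => s; exact: maxC. Qed.

Lemma C0maxx : idempotent_op C0max.
Proof. by move=> f; apply: C0P => s; exact: maxxx. Qed.

Lemma C0add_maxr : right_distributive C0add C0max.
Proof. by move=> f g h; apply: C0P => s; exact: addr_maxr. Qed.

HB.instance Definition _ :=
  Nmodule_isChar1.Build C C0maxA C0maxC C0maxx C0add_maxr.

End C0SemiRing.

(* The supremum is taken in [[0, +oo]], so that it is [0] when [S] is empty. *)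
Definition sup_norm (K : realType) (S : Type) (f : S -> K) : \bar K :=
  ereal_sup (0%E |` [set (`|f s|)%:E | s in [set: S]]).

Definition sup_dist (K : realType) (S : Type) (f g : S -> K) : \bar K :=
  sup_norm (fun s => f s - g s).

Definition semiring_iso (R R' : char1SemiRingType) (f : R -> R') : Prop :=
  [/\ bijective f,
      f 0 = 0,
      forall X Y, f (X + Y) = f X + f Y &
      forall X Y, f (X ⊕ Y) = f X ⊕ f Y].

Definition is_positive_cone (R : cancelChar1SemiRingType) : Prop :=
  forall Z : semifrac R, (exists X : R, to_semifrac X = Z) <-> 0 ≼ Z.

Section Theta.
Variables (K : realType) (R : cancelChar1SemiRingType) (E : R).
Local Notation S := (spectrum K (to_semifrac E)).

Lemma char_ge0 (phi : S) (Z : semifrac R) : 0 ≼ Z -> 0 <= phi Z.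
Proof.
have phi0 : phi 0 = 0.
  by apply: (addrI (phi 0)); rewrite -char_add !addr0.
by rewrite /char1_le => Z0; rewrite -Z0 char_oplus phi0 le_max lexx.
Qed.

Hypothesis hR : is_positive_cone R.

Lemma evaluation_ge0 (X : R) (phi : S) : 0 <= evaluation (to_semifrac X) phi.
Proof. by apply/char_ge0/hR; exists X. Qed.

Definition Theta (X : R) : C0nonneg S K :=
  MkC0nonneg (@evaluation_continuous K _ _ (to_semifrac X)) (evaluation_ge0 X).

End Theta.

(* Main.v *)
(** The semi-field F is a divisible lattice-ordered abelian group with order
    unit E, and r is a lattice norm on it; F is complete because Z is the
    difference of Z ⊕ 0 and (- Z) ⊕ 0, two elements of R that depend
    1-Lipschitz on Z.

    For Y ≽ 0 with r Y > 0, a character phi with phi Y = r Y is a minimal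
    element (Zorn) among the maps p <= r (_ ⊕ 0) that are subadditive,
    homogeneous and max-preserving: such a p is bounded below by another one,
    X |-> inf_n (p (X + nY) - n (p Y)), whose value at - Y is at most - p Y, so
    at a minimal p subadditivity becomes additivity. This gives r as a supremum
    over the spectrum, hence the isometry. The spectrum is compact (ultrafilters),
    and a lattice Stone-Weierstrass argument with completeness of F gives
    surjectivity. *)

Require Import Defs.
From HB Require Import structures.
From mathcomp Require Import all_boot all_order all_algebra.
From mathcomp Require Import all_classical all_reals all_analysis.
Import Order.TTheory GRing.Theory Num.Theory.
Import numFieldNormedType.Exports.
Set Implicit Arguments.
Unset Strict Implicit.
Unset Printing Implicit Defensive.

Local Open Scope classical_set_scope.
Local Open Scope ring_scope.

(** * Order and divisibility in lattice-ordered abelian groups *)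

Lemma addr_oplus (R : char1SemiRingType) (X Y Z : R) :
  X + (Y ⊕ Z) = (X + Y) ⊕ (X + Z).
Proof. exact: add_oplusr. Qed.

Section LatticeOrderedGroup.
Variable F : char1SemiFieldType.
Implicit Types (X Y Z W : F) (n : nat).

Lemma char1_lexx X : X ≼ X.
Proof. exact: oplusxx. Qed.

Lemma char1_le_trans Y X Z : X ≼ Y -> Y ≼ Z -> X ≼ Z.
Proof. by rewrite /char1_le => XY <-; rewrite oplusA XY. Qed.

Lemma char1_le_anti X Y : X ≼ Y -> Y ≼ X -> X = Y.
Proof. by move=> XY YX; rewrite -XY oplusC YX. Qed.

Lemma char1_le_joinl X Y : X ≼ X ⊕ Y.
Proof. by rewrite /char1_le oplusA oplusxx. Qed.

Lemma char1_le_joinr X Y : Y ≼ X ⊕ Y.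
Proof. by rewrite oplusC; exact: char1_le_joinl. Qed.

Lemma char1_join_le X Y Z : X ≼ Z -> Y ≼ Z -> X ⊕ Y ≼ Z.
Proof. by rewrite /char1_le => XZ YZ; rewrite -oplusA YZ. Qed.

Lemma char1_leD2l X Y Z : (X + Y ≼ X + Z) = (Y ≼ Z).
Proof.
by apply/propext; rewrite /char1_le -addr_oplus; split=> [/addrI|->].
Qed.

Lemma char1_leD X Y Z W : X ≼ Y -> Z ≼ W -> X + Z ≼ Y + W.
Proof.
move=> XY ZW; apply: (@char1_le_trans (X + W)); first by rewrite char1_leD2l.
by rewrite ![_ + W]addrC char1_leD2l.
Qed.

Lemma char1_le_subl X Y Z : (X - Y ≼ Z) = (X ≼ Y + Z).
Proof. by rewrite -(char1_leD2l Y) addrCA subrr addr0. Qed.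

Lemma char1_le_sub0 X Y : (X - Y ≼ 0) = (X ≼ Y).
Proof. by rewrite char1_le_subl addr0. Qed.

Lemma char1_leNl X Y : (- X ≼ Y) = (- Y ≼ X).
Proof.
by rewrite -[- X]add0r -[- Y]add0r !char1_le_subl addrC.
Qed.

Lemma char1_leN2 X Y : (- X ≼ - Y) = (Y ≼ X).
Proof. by rewrite char1_leNl opprK. Qed.

Lemma char1_leMn n X Y : X ≼ Y -> X *+ n ≼ Y *+ n.
Proof.
move=> XY; elim: n => [|n IH]; first by rewrite !mulr0n; exact: char1_lexx.
by rewrite !mulrS; exact: char1_leD.
Qed.

(* n (X ⊕ 0) is the join of the kX for k <= n. *)
Lemma char1_mulrn_join n X : (X ⊕ 0) *+ n.+1 = X *+ n.+1 ⊕ (X ⊕ 0) *+ n.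
Proof.
elim: n => [|n IH]; first by rewrite !mulr1n mulr0n.
rewrite mulrSr addr_oplus addr0 {1}IH [_ + X]addrC addr_oplus -mulrS -oplusA.
congr (_ ⊕ _).
by rewrite addrC mulrSr -addr_oplus oplusA oplusxx.
Qed.

(** In [char1_mulrn_join] the term [X *+ n.+1] is absorbed, because [(X ⊕ 0) *+ n] is nonnegative;
    cancelling [(X ⊕ 0) *+ n] leaves [X ⊕ 0 = 0]. *)
Lemma char1_mulrn_le0 n X : X *+ n.+1 ≼ 0 -> X ≼ 0.
Proof.
move=> nX0; have := char1_mulrn_join n X.
have /(char1_le_trans nX0) -> : 0 ≼ (X ⊕ 0) *+ n.
  by rewrite -[X in X ≼ _](mul0rn _ n); apply/char1_leMn/char1_le_joinr.
by rewrite mulrSr -[RHS]addr0 => /addrI.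
Qed.

Lemma char1_mulrn_le n X Y : X *+ n.+1 ≼ Y *+ n.+1 -> X ≼ Y.
Proof.
move=> XY; rewrite -char1_le_sub0; apply: (@char1_mulrn_le0 n).
by rewrite mulrnBl char1_le_sub0.
Qed.

Lemma char1_mulrn_inj n X Y : X *+ n.+1 = Y *+ n.+1 -> X = Y.
Proof.
move=> XY; apply: char1_le_anti; apply: (@char1_mulrn_le n);
  by rewrite XY; exact: char1_lexx.
Qed.

Lemma char1_pos_partMn n X : (X ⊕ 0) *+ n ≼ X *+ n ⊕ 0.
Proof.
case: n => [|n]; first by rewrite !mulr0n oplusxx; exact: char1_lexx.
set W := X *+ n.+1 ⊕ 0; have W0 : 0 ≼ W by exact: char1_le_joinr.
(* Multiply by [n.+1] and divide at the end: n.+1 times kX is k times [X *+ n.+1], hence at most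
   [W *+ k], and [W *+ k ≼ W *+ n.+1] since [W] is nonnegative. *)
have kX k : (k <= n.+1)%N -> X *+ k ≼ W.
  move=> kn; apply: (@char1_mulrn_le n); rewrite mulrnAC.
  apply: (@char1_le_trans (W *+ k)).
    by apply: char1_leMn; exact: char1_le_joinl.
  rewrite -(subnK kn) mulrnDr -[X in X ≼ _]add0r; apply: char1_leD.
    by rewrite -[X in X ≼ _](mul0rn _ (n.+1 - k)); exact: char1_leMn.
  exact: char1_lexx.
suff kD k : (k <= n.+1)%N -> (X ⊕ 0) *+ k ≼ W by exact: kD.
elim: k => [|k IH] kn; first by rewrite mulr0n.
by rewrite char1_mulrn_join; apply: char1_join_le; [exact: kX|exact/IH/ltnW].
Qed.

(** Twice [X ⊕ - X] is the join of 2X, 0 and -2X, and the inequality can be divided by 2. *)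
Lemma char1_abs_ge0 X : 0 ≼ X ⊕ - X.
Proof.
apply: (@char1_mulrn_le 1); rewrite mul0rn mulr2n addr_oplus ![_ + X]addrC.
rewrite [_ + - X]addrC !addr_oplus subrr addNr -oplusA [in X in _ ≼ X]oplusC.
rewrite -oplusA; exact: char1_le_joinl.
Qed.

End LatticeOrderedGroup.

(** * The embedding of the semi-ring in its group of differences *)

Section SemiFracTheory.
Variable R : cancelChar1SemiRingType.
Implicit Types (X Y : R) (Z : semifrac R).

Lemma to_semifracD X Y : to_semifrac (X + Y) = to_semifrac X + to_semifrac Y.
Proof. by apply/esym; rewrite [LHS]SemiFrac.addE /= addr0. Qed.

Lemma to_semifrac_oplus X Y :
  to_semifrac (X ⊕ Y) = to_semifrac X ⊕ to_semifrac Y.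
Proof. by apply/esym; rewrite [LHS]SemiFrac.joinE /= !addr0. Qed.

Lemma to_semifrac0 : to_semifrac (0 : R) = 0.
Proof. by []. Qed.

Lemma to_semifracMn X n : to_semifrac (X *+ n) = to_semifrac X *+ n.
Proof.
elim: n => [|n IH]; first by rewrite !mulr0n.
by rewrite !mulrS to_semifracD IH.
Qed.

Lemma to_semifrac_inj : injective (@to_semifrac R).
Proof. by move=> X Y /SemiFrac.piE; rewrite /= !addr0. Qed.

Lemma to_semifrac_le X Y : to_semifrac X ≼ to_semifrac Y -> X ≼ Y.
Proof. by rewrite /char1_le -to_semifrac_oplus => /to_semifrac_inj. Qed.

Lemma semifrac_subP Z : exists X Y, Z = to_semifrac X - to_semifrac Y.
Proof.
elim/SemiFrac.quotP: Z => -[X Y]; exists X, Y.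
rewrite [X in _ - X]/to_semifrac; apply/esym.
by rewrite [X in _ + X]SemiFrac.oppE [LHS]SemiFrac.addE /= addr0 add0r.
Qed.
End SemiFracTheory.

(** * Rational multiples of the unit, and order bounds by them *)

Section UnitMultiples.
Variables (R : cancelChar1SemiRingType) (E : R).
Hypothesis perfectR : perfect R.
Implicit Types (X Y Z W : semifrac R) (t s : rat).

Local Notation uE t := (to_semifrac (rat_act t E)).

Lemma rat_actP t (X : R) :
  rat_act t X *+ `|denq t|%N = X *+ `|numq t|%N.
Proof.
have d0 : (0 < `|denq t|)%N by rewrite absz_gt0 denq_eq0.
have [Y Yd] := perfectR d0 (X *+ `|numq t|%N).
exact: (@xgetI _ 0 [set Y : R | Y *+ `|denq t|%N = X *+ `|numq t|%N] Y).
Qed.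

Lemma rat_nat_frac t : 0 <= t -> t * (`|denq t|%N)%:R = (`|numq t|%N)%:R.
Proof.
move=> t0; rewrite -{1}[t]divq_num_den.
rewrite !natr_absz gtr0_norm ?denq_gt0// ger0_norm ?numq_ge0//.
by rewrite divfK // intr_eq0 denq_eq0.
Qed.

(** Frees [rat_act] from the reduced fraction of [t]: any representation m / n determines [uE t],
    because the group of differences has no torsion. *)
Lemma unit_multiple_unique t m n Y : 0 <= t -> (0 < n)%N ->
  t * n%:R = m%:R -> Y *+ n = to_semifrac E *+ m -> Y = uE t.
Proof.
move=> t0 n0 tn Yn.
have d0 : (0 < `|denq t|)%N by rewrite absz_gt0 denq_eq0.
have k0 : (0 < `|denq t| * n)%N by rewrite muln_gt0 d0.
apply: (@char1_mulrn_inj _ (`|denq t| * n).-1); rewrite prednK//.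
rewrite [in RHS]mulrnA -to_semifracMn rat_actP to_semifracMn -mulrnA.
rewrite [in LHS]mulnC [in LHS]mulrnA Yn -mulrnA; congr (_ *+ _).
apply/eqP; rewrite -(eqr_nat rat) !natrM -tn -rat_nat_frac//.
by rewrite mulrAC.
Qed.

Lemma unit_multipleMden t :
  uE t *+ `|denq t|%N = to_semifrac E *+ `|numq t|%N.
Proof. by rewrite -!to_semifracMn rat_actP. Qed.

Lemma unit_multipleD t s : 0 <= t -> 0 <= s -> uE (t + s) = uE t + uE s.
Proof.
move=> t0 s0; apply/esym.
pose a := `|denq t|%N; pose b := `|denq s|%N.
apply: (@unit_multiple_unique _ (`|numq t| * b + `|numq s| * a)%N (a * b)%N).
- exact: addr_ge0.
- by rewrite muln_gt0 !absz_gt0 !denq_eq0.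
- rewrite natrD !natrM -!rat_nat_frac// mulrDl mulrA; congr (_ + _).
  by rewrite [_ * b%:R]mulrC mulrA.
- rewrite mulrnDl mulrnA unit_multipleMden mulnC mulrnA unit_multipleMden.
  by rewrite -!mulrnA -mulrnDr.
Qed.

Lemma unit_multiple0 : uE 0 = 0.
Proof. by apply/esym/(@unit_multiple_unique _ 0 1); rewrite ?mul0r ?mul0rn. Qed.

Lemma unit_multiple1 : uE 1 = to_semifrac E.
Proof. by apply/esym/(@unit_multiple_unique _ 1 1); rewrite ?mulr1. Qed.

Lemma unit_multipleMn t n : 0 <= t -> uE t *+ n = uE (t *+ n).
Proof.
move=> t0; elim: n => [|n IH]; first by rewrite !mulr0n unit_multiple0.
by rewrite !mulrS unit_multipleD ?mulrn_wge0// IH.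
Qed.

Hypothesis unitE : order_unit E.

(** The bound for the element 0 makes [uE t] nonnegative for some positive [t]; a positive multiple
    of it is a positive multiple of [E], and one divides. *)
Lemma order_unit_ge0 : 0 ≼ to_semifrac E.
Proof.
have [t [t0 [Et _]]] := unitE 0.
have {}Et : 0 ≼ uE t by move: Et; rewrite to_semifrac0 char1_leNl oppr0.
have n0 : (0 < `|numq t|)%N by rewrite absz_gt0 numq_eq0 gt_eqF.
apply: (@char1_mulrn_le _ (`|numq t|).-1); rewrite prednK// -unit_multipleMden.
by rewrite mul0rn -[X in X ≼ _](mul0rn _ `|denq t|); exact: char1_leMn.
Qed.

Lemma unit_multiple_ge0 t : 0 ≼ uE t.
Proof.
have d0 : (0 < `|denq t|)%N by rewrite absz_gt0 denq_eq0.
apply: (@char1_mulrn_le _ (`|denq t|).-1); rewrite prednK// unit_multipleMden.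
rewrite mul0rn -[X in X ≼ _](mul0rn _ `|numq t|).
exact/char1_leMn/order_unit_ge0.
Qed.

Lemma unit_multiple_le t s : 0 <= t -> t <= s -> uE t ≼ uE s.
Proof.
move=> t0 ts; rewrite -[s](subrK t) addrC unit_multipleD ?subr_ge0//.
by rewrite -[X in X ≼ _]addr0 char1_leD2l; exact: unit_multiple_ge0.
Qed.

Lemma bounded_byE t Z : bounded_by E t Z <-> Z ≼ uE t /\ - Z ≼ uE t.
Proof. by rewrite /bounded_by char1_leNl; split=> -[]. Qed.

Lemma bounded_by_le t s Z :
  0 <= t -> t <= s -> bounded_by E t Z -> bounded_by E s Z.
Proof.
move=> t0 ts; have ets := unit_multiple_le t0 ts.
by rewrite !bounded_byE => -[Zt NZt]; split; exact: char1_le_trans ets.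
Qed.

Lemma bounded_byN t Z : bounded_by E t Z -> bounded_by E t (- Z).
Proof. by rewrite !bounded_byE opprK => -[]. Qed.

Lemma bounded_byD t s Z W : 0 <= t -> 0 <= s ->
  bounded_by E t Z -> bounded_by E s W -> bounded_by E (t + s) (Z + W).
Proof.
move=> t0 s0; rewrite !bounded_byE unit_multipleD// opprD.
by move=> [Zt NZt] [Ws NWs]; split; exact: char1_leD.
Qed.

Lemma bounded_byMn t n Z : 0 <= t ->
  bounded_by E (t *+ n.+1) (Z *+ n.+1) <-> bounded_by E t Z.
Proof.
move=> t0; rewrite !bounded_byE -unit_multipleMn// -mulNrn.
split=> -[Zt NZt]; last by split; exact: char1_leMn.
by split; exact: (@char1_mulrn_le _ n).
Qed.

Lemma bounded_by_oplus t Z W :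
  bounded_by E t Z -> bounded_by E t W -> bounded_by E t (Z ⊕ W).
Proof.
rewrite !bounded_byE => -[Zt NZt] [Wt _]; split; first exact: char1_join_le.
apply: char1_le_trans NZt; rewrite char1_leN2; exact: char1_le_joinl.
Qed.

Lemma bounded_by_exists Z : exists t, 0 < t /\ bounded_by E t Z.
Proof.
have [X [Y ->]] := semifrac_subP Z.
have [t [t0 Xt]] := unitE X; have [s [s0 Ys]] := unitE Y.
exists (t + s); split; first exact: addr_gt0.
apply: bounded_byD; rewrite ?ltW//; exact: bounded_byN.
Qed.

Lemma bounded_by_between t Z W : 0 ≼ Z -> Z ≼ W ->
  bounded_by E t W -> bounded_by E t Z.
Proof.
move=> Z0 ZW; rewrite !bounded_byE => -[Wt _]; split.
  exact: char1_le_trans Wt.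
apply: (@char1_le_trans _ 0); first by rewrite char1_leNl oppr0.
exact: unit_multiple_ge0.
Qed.

(** From [Z ≼ W + uE t] and [0 ≼ uE t] follows [Z ⊕ 0 ≼ (W ⊕ 0) + uE t], and symmetrically. This
    makes the positive part 1-Lipschitz. *)
Lemma bounded_by_pos_part t Z W : bounded_by E t (Z - W) ->
  bounded_by E t ((Z ⊕ 0) - (W ⊕ 0)).
Proof.
have half X Y : X - Y ≼ uE t -> (X ⊕ 0) - (Y ⊕ 0) ≼ uE t.
  rewrite !char1_le_subl => XY; apply: char1_join_le.
    apply: (char1_le_trans XY); rewrite ![_ + uE t]addrC char1_leD2l.
    exact: char1_le_joinl.
  rewrite -[X in X ≼ _]addr0; apply: char1_leD; first exact: char1_le_joinr.
  exact: unit_multiple_ge0.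
by rewrite !bounded_byE !opprB => -[ZW WZ]; split; exact: half.
Qed.

Lemma bounded_by_abs t Z : bounded_by E t (Z ⊕ - Z) -> bounded_by E t Z.
Proof.
rewrite !bounded_byE => -[Zt _]; split; apply: char1_le_trans Zt.
  exact: char1_le_joinl.
exact: char1_le_joinr.
Qed.

End UnitMultiples.

(** * The radius as a lattice norm, and completeness of the semi-field *)

Section UnitRadius.
Variables (K : realType) (R : cancelChar1SemiRingType) (E : R).
Hypotheses (perfectR : perfect R) (unitE : order_unit E).
Implicit Types (X Y Z W : semifrac R) (t s : rat) (c : K).

Local Notation uE t := (to_semifrac (rat_act t E)).
Local Notation r := (@unit_radius K R E).

Let radii Z := [set (ratr t : K) | t in [set t : rat | 0 < t /\ bounded_by E t Z]].

Let radii_nonempty Z : radii Z !=set0.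
Proof.
by have [t tZ] := bounded_by_exists perfectR unitE Z; exists (ratr t), t.
Qed.

Let radii_lbound0 Z : lbound (radii Z) 0.
Proof. by move=> _ [t [t0 _] <-]; rewrite ler0q ltW. Qed.

Lemma unit_radius_ge0 Z : 0 <= r Z.
Proof. by apply: lb_le_inf; [exact: radii_nonempty | exact: radii_lbound0]. Qed.

Lemma unit_radius_le t Z : 0 < t -> bounded_by E t Z -> r Z <= ratr t.
Proof.
by move=> t0 Zt; apply: ge_inf; [exists 0; exact: (@radii_lbound0 Z)|exists t].
Qed.

Lemma unit_radius_lt Z c :
  r Z < c -> exists t, [/\ 0 < t, ratr t < c & bounded_by E t Z].
Proof. by move=> /(inf_lt (radii_nonempty Z))[_ [t [t0 Zt] <-] tc]; exists t. Qed.

Lemma unit_radius_mono Z W :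
  (forall t, 0 < t -> bounded_by E t W -> bounded_by E t Z) -> r Z <= r W.
Proof.
move=> WZ; rewrite leNgt; apply/negP => /unit_radius_lt[t [t0 + Wt]].
by rewrite ltNge => /negP; apply; apply: unit_radius_le => //; exact: WZ.
Qed.

Lemma unit_radiusN Z : r (- Z) = r Z.
Proof.
apply/le_anti/andP; split; apply: unit_radius_mono => t _; last first.
  by rewrite -{2}[Z]opprK; exact: bounded_byN.
exact: bounded_byN.
Qed.

Lemma unit_radius_addgt0 Z c :
  0 < c -> exists t, [/\ 0 < t, ratr t < r Z + c & bounded_by E t Z].
Proof. by move=> c0; apply: unit_radius_lt; rewrite ltrDl. Qed.

Lemma unit_radiusD Z W : r (Z + W) <= r Z + r W.
Proof.
apply/ler_addgt0Pr => c c0; have c20 : 0 < c / 2 by rewrite divr_gt0.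
have [t [t0 tZ Zt]] := unit_radius_addgt0 Z c20.
have [s [s0 sW Ws]] := unit_radius_addgt0 W c20.
have ts0 : 0 < t + s by exact: addr_gt0.
apply: (le_trans (unit_radius_le ts0 _)).
  by apply: bounded_byD => //; exact: ltW.
by rewrite rmorphD /= [c]splitr addrACA lerD// ltW.
Qed.

(** Multiplication by [n.+1] is a bijection from the rational bounds of [Z] to those of [Z *+ n.+1];
    each inequality transports a bound in one direction. *)
Lemma unit_radiusMn Z n : r (Z *+ n.+1) = r Z *+ n.+1.
Proof.
have n0 : (0 : K) < n.+1%:R by rewrite ltr0n.
have nQ0 : (0 : rat) < n.+1%:R by rewrite ltr0n.
apply/le_anti/andP; split.
  rewrite -mulr_natr -ler_pdivrMr// leNgt; apply/negP => /unit_radius_lt.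
  move=> [t [t0 + Zt]].
  rewrite ltr_pdivlMr// ltNge => /negP; apply.
  rewrite -[n.+1%:R](ratr_nat K) -rmorphM /= mulr_natr.
  apply: unit_radius_le; first by rewrite pmulrn_lgt0.
  by apply/(bounded_byMn E perfectR n Z (ltW t0)).
rewrite leNgt; apply/negP => /unit_radius_lt[t [t0 + Zt]].
rewrite ltNge => /negP; apply.
rewrite -mulr_natr -ler_pdivlMr// -[n.+1%:R](ratr_nat K) -fmorph_div /=.
apply: unit_radius_le; first exact: divr_gt0.
apply/(bounded_byMn E perfectR n); first by rewrite ltW// divr_gt0.
by rewrite -[X in bounded_by _ X _]mulr_natr divfK// gt_eqF.
Qed.

Lemma unit_radius_oplus Z W : r (Z ⊕ W) <= Num.max (r Z) (r W).
Proof.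
rewrite leNgt; apply/negP; rewrite gt_max => /andP[].
move=> /unit_radius_lt[t [t0 tZW Zt]] /unit_radius_lt[s [s0 sZW Ws]].
have m0 : 0 < Num.max t s by rewrite lt_max t0.
have : r (Z ⊕ W) <= ratr (Num.max t s).
  apply: unit_radius_le => //; apply: bounded_by_oplus => //.
  - by apply: (bounded_by_le perfectR unitE (ltW t0) _ Zt); rewrite le_max lexx.
  - by apply: (bounded_by_le perfectR unitE (ltW s0) _ Ws);
    rewrite le_max lexx orbT.
apply/negP; rewrite -ltNge.
by case: (leP t s).
Qed.

Lemma unit_radius0 : r 0 = 0.
Proof.
have := unit_radiusMn 0 1; rewrite mul0rn mulr2n => /eqP.
by rewrite -[X in X == _]addr0 eq_sym (inj_eq (addrI _)) => /eqP.
Qed.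

(** Equality fails for the trivial semi-ring, whose radius vanishes. *)
Lemma unit_radius_unit_le1 : r (to_semifrac E) <= 1.
Proof.
rewrite -(rmorph1 (@ratr K)); apply: unit_radius_le => //.
apply/bounded_byE; rewrite (unit_multiple1 E perfectR).
split; first exact: char1_lexx.
have E0 := order_unit_ge0 perfectR unitE.
by apply: (char1_le_trans _ E0); rewrite char1_leNl oppr0.
Qed.

Lemma unit_radius_pos_part Z W : r ((Z ⊕ 0) - (W ⊕ 0)) <= r (Z - W).
Proof. by apply: unit_radius_mono => t _; exact: bounded_by_pos_part. Qed.

Lemma unit_radius_abs Z : r Z <= r (Z ⊕ - Z).
Proof. by apply: unit_radius_mono => t _; exact: bounded_by_abs. Qed.

Lemma unit_radius_between Z W : 0 ≼ Z -> Z ≼ W -> r Z <= r W.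
Proof.
by move=> Z0 ZW; apply: unit_radius_mono => t _; exact: bounded_by_between.
Qed.

Hypothesis unit_radius_eq0 : forall Z, r Z = 0 -> Z = 0.

Lemma semifrac_dist_is_distance : is_distance (@semifrac_dist K R E).
Proof.
split.
- by move=> x y; exact: unit_radius_ge0.
- move=> x y; split=> [/unit_radius_eq0/eqP|->]; first by rewrite subr_eq0 => /eqP.
  by rewrite /semifrac_dist subrr unit_radius0.
- by move=> x y; rewrite /semifrac_dist -unit_radiusN opprB.
- by move=> x y z; rewrite /semifrac_dist -[x - z](subrKA y) unit_radiusD.
Qed.

Hypothesis completeR : complete_dist (@semiring_dist K R E).
Hypothesis coneR : is_positive_cone R.

Let pos_part_cvg (u : nat -> semifrac R) : cauchy_seq (@semifrac_dist K R E) u ->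
  exists L : semifrac R,
    @semifrac_dist K R E (u n ⊕ 0) L @[n --> \oo] --> (0 : K).
Proof.
move=> uC.
have /choice[v vu] n : exists X : R, to_semifrac X = u n ⊕ 0.
  by apply/coneR; exact: char1_le_joinr.
have [|l vl] := completeR (u := v); last first.
  exists (to_semifrac l).
  rewrite (_ : (fun n => _) = fun n => semiring_dist K E (v n) l)//.
  by apply/funext => n; rewrite /semiring_dist vu.
move=> e /uC[N Nu]; exists N => m n Nm Nn.
rewrite /semiring_dist !vu; apply: le_lt_trans (Nu _ _ Nm Nn).
exact: unit_radius_pos_part.
Qed.

Lemma complete_semifrac_dist : complete_dist (@semifrac_dist K R E).
Proof.
move=> u uC; have [L1 uL1] := pos_part_cvg uC.
have [|L2 uL2] := pos_part_cvg (u := fun n => - u n).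
  move=> e /uC[N Nu]; exists N => m n Nm Nn.
  by rewrite /semifrac_dist -opprD unit_radiusN; exact: Nu.
exists (L1 - L2).
have : @semifrac_dist K R E (u n ⊕ 0) L1 + @semifrac_dist K R E (- u n ⊕ 0) L2
    @[n --> \oo] --> (0 : K).
  by rewrite -[X in _ --> X]addr0; exact: cvgD.
apply: squeeze_cvgr; last exact: cvg_cst.
near=> n; rewrite unit_radius_ge0 /=.
(* Adding [- u n ⊕ 0] to [u n] distributes over the join and gives [0 ⊕ u n]. *)
have {1}-> : u n = (u n ⊕ 0) - (- u n ⊕ 0).
  apply: (addIr (- u n ⊕ 0)); rewrite subrK addr_oplus subrr addr0.
  exact: oplusC.
rewrite /semifrac_dist opprB [L2 - L1]addrC addrACA [- (- u n ⊕ 0) + _]addrC.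
rewrite -[L2 - _]opprB -[r (_ ⊕ 0 - L2)]unit_radiusN.
exact: unit_radiusD.
Unshelve. all: by end_near. Qed.
End UnitRadius.

(** * Max-sublinear maps and the additivity of minimal ones *)

Section MaxSublinear.
Variables (K : realType) (F : char1SemiFieldType).
Implicit Types (X Y Z : F) (p q : F -> K).

(** The third condition is one half of homogeneity under positive integers; subadditivity supplies
    the other half. *)
Definition max_sublinear p : Prop :=
  [/\ forall X Y, p (X ⊕ Y) = Num.max (p X) (p Y),
      forall X Y, p (X + Y) <= p X + p Y &
      forall X n, p X *+ n.+1 <= p (X *+ n.+1)].

Lemma max_sublinear0 p : max_sublinear p -> p 0 = 0.
Proof.
move=> [_ pD pM]; apply/le_anti/andP; split.
  by have := pM 0 1; rewrite mul0rn mulr2n -subr_ge0 opprD addNKr oppr_ge0.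
by have := pD 0 0; rewrite addr0 -subr_ge0 addrK.
Qed.

Lemma max_sublinearN p X : max_sublinear p -> - p (- X) <= p X.
Proof.
move=> pS; have [_ pD _] := pS.
rewrite -subr_ge0 opprK; have := pD X (- X).
by rewrite subrr max_sublinear0.
Qed.

Section DirectedInfimum.
Variables (I : Type) (i0 : I) (f : I -> F -> K) (b : F -> K).
Hypothesis f_bounded : forall i X, b X <= f i X.
Hypothesis f_directed : forall i j, exists k, forall X,
  f k X <= f i X /\ f k X <= f j X.
Hypothesis f_max : forall i X Y, f i (X ⊕ Y) = Num.max (f i X) (f i Y).
Hypothesis f_add : forall i X Y, exists k, f k (X + Y) <= f i X + f i Y.
Hypothesis f_mulrn : forall i X n, exists k, f k X *+ n.+1 <= f i (X *+ n.+1).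

Let m X := inf (range (f ^~ X)).

Let m_le i X : m X <= f i X.
Proof. by apply: ge_inf; [exists (b X) => _ [j _ <-] | exists i]. Qed.

Let m_ge X (c : K) : (forall i, c <= f i X) -> c <= m X.
Proof.
by move=> cf; apply: lb_le_inf; [exists (f i0 X), i0 | move=> _ [i _ <-]].
Qed.

Let m_lt X (c : K) : m X < c -> exists i, f i X < c.
Proof.
move=> mc; have [|_ [i _ <-] ic] := inf_lt _ mc; last by exists i.
by exists (f i0 X), i0.
Qed.

(** Directedness yields one index at which two given values are both close to their infima. The
    lemma serves for the sequence behind [slope_at], where sums and multiples change the index, and
    for chains in Zorn's lemma. *)
Lemma directed_inf_max_sublinear : max_sublinear (fun X => inf (range (f ^~ X))).
Proof.
split=> [X Y|X Y|X n]; rewrite -?/(m _).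
- apply/le_anti/andP; split; last first.
    rewrite ge_max; apply/andP; split; apply: m_ge => i;
      by apply: (le_trans (m_le i _)); rewrite f_max le_max lexx ?orbT.
  rewrite leNgt gt_max; apply/negP => /andP[/m_lt[i iX] /m_lt[j jY]].
  have [k fk] := f_directed i j; have := m_le k (X ⊕ Y); apply/negP.
  rewrite -ltNge f_max gt_max; apply/andP; split.
    exact: le_lt_trans (proj1 (fk X)) iX.
  exact: le_lt_trans (proj2 (fk Y)) jY.
- apply/ler_addgt0Pr => c c0; have c20 : 0 < c / 2 by rewrite divr_gt0.
  have [i iX] : exists i, f i X < m X + c / 2 by apply: m_lt; rewrite ltrDl.
  have [j jY] : exists j, f j Y < m Y + c / 2 by apply: m_lt; rewrite ltrDl.
  have [k fk] := f_directed i j; have [l fl] := f_add k X Y.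
  apply: (le_trans (m_le l _)); apply: (le_trans fl).
  rewrite [c]splitr addrACA; apply: lerD.
    exact: (le_trans (proj1 (fk _)) (ltW iX)).
  exact: (le_trans (proj2 (fk _)) (ltW jY)).
- apply: m_ge => i; have [k] := f_mulrn i X n; apply: le_trans.
  by rewrite lerMn2r m_le orbT.
Qed.

End DirectedInfimum.

(* The largest max-sublinear minorant of p that is at most - p Y at - Y; the
   sequence below is nonincreasing in n. *)
Definition slope_at p Y X : K := inf (range (fun n => p (X + Y *+ n) - p Y *+ n)).

Section SlopeAt.
Variables (p : F -> K) (Y : F).
Hypothesis pS : max_sublinear p.

Let f n X := p (X + Y *+ n) - p Y *+ n.

(** Split [Y *+ n] as [(X + Y *+ n) - X] and use [p Y *+ n <= p (Y *+ n)]. The bound is independent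
    of [n], so the infimum is a genuine one. *)
Let f_bounded n X : - p (- X) <= f n X.
Proof.
have [_ pD pM] := pS; rewrite /f lerBrDr addrC lerBlDr.
have pYn : p Y *+ n <= p (Y *+ n).
  by case: n => [|n]; [rewrite !mulr0n max_sublinear0 | exact: pM].
apply: (le_trans pYn); apply: le_trans (pD _ _).
by rewrite addrAC subrr add0r.
Qed.

Let f_nonincr n k X : f (n + k) X <= f n X.
Proof.
have [_ pD _] := pS; elim: k => [|k IH]; first by rewrite addn0.
apply: le_trans IH; rewrite addnS /f !mulrSr lerBlDr.
by rewrite [leRHS]addrA subrK addrA; exact: pD.
Qed.

Lemma slope_at_max_sublinear : max_sublinear (slope_at p Y).
Proof.
have [pmax pD pM] := pS.
apply: (@directed_inf_max_sublinear nat 0 f (fun X => - p (- X))) => //.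
- move=> i j; exists (i + j)%N => X; rewrite f_nonincr; split=> //.
  by rewrite addnC f_nonincr.
- move=> i X Z; rewrite /f [X ⊕ Z + _]addrC addr_oplus pmax addr_maxl.
  by rewrite ![Y *+ i + _]addrC.
(* The arguments [X + Y *+ i] and [Z + Y *+ i] add up to one with [Y *+ (i + i)]. *)
- move=> i X Z; exists (i + i)%N.
  rewrite /f !mulrnDr addrACA [X in _ <= X]addrACA -opprD; apply: lerB => //.
(* Pass to the later index [i * n.+1], where the argument is exactly [(X + Y *+ i) *+ n.+1]. *)
- move=> i X n; exists i; apply: le_trans (f_nonincr i (i * n) _).
  rewrite /f -mulnS mulrnBl -!mulrnA; apply: lerB => //.
  by rewrite mulrnA -mulrnDl; exact: pM.
Qed.

Lemma slope_at_le X : slope_at p Y X <= p X.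
Proof.
apply: (@le_trans _ _ (f 0%N X)); last by rewrite /f !mulr0n addr0 subr0.
by apply: ge_inf; [exists (- p (- X)) => _ [j _ <-]; exact: f_bounded | exists 0%N].
Qed.

Lemma slope_atN : slope_at p Y (- Y) <= - p Y.
Proof.
apply: (@le_trans _ _ (f 1%N (- Y))).
  apply: ge_inf; last by exists 1%N.
  by exists (- p (- - Y)) => _ [j _ <-]; exact: f_bounded.
by rewrite /f !mulr1n addNr max_sublinear0// add0r.
Qed.

End SlopeAt.

(** Zorn's lemma for the reversed pointwise order. A chain is bounded by its pointwise infimum,
    which is finite because every minorant [p] of [q] satisfies [- q (- X) <= - p (- X) <= p X]. *)
Lemma minimal_max_sublinear q : max_sublinear q ->
  exists2 p, max_sublinear p /\ (forall X, p X <= q X) &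
    forall p', max_sublinear p' -> (forall X, p' X <= p X) ->
      forall X, p X <= p' X.
Proof.
move=> qS.
pose T := {p : F -> K | max_sublinear p /\ (forall X, p X <= q X)}.
have q_le_q : max_sublinear q /\ (forall X, q X <= q X) by [].
pose below (p p' : T) := `[< forall X, sval p' X <= sval p X >].
have [p|p1 p2 p3 /asboolP p12 /asboolP p23|A Atot|] :=
  @ZL_preorder T (exist _ q q_le_q) below.
- by apply/asboolP.
- by apply/asboolP => X; exact: le_trans (p12 X).
(* The empty chain is bounded by [q] itself. *)
- have [[s0 As0]|A0] := pselect (A !=set0); last first.
    by exists (exist _ q q_le_q) => s As; case: A0; exists s.
  pose f (s : {s | A s}) : F -> K := sval (sval s).
  have f_bounded s X : - q (- X) <= f s X.
    have [sS sq] := svalP (sval s).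
    by apply: le_trans (max_sublinearN X sS); rewrite lerN2; exact: sq.
  have infS : max_sublinear (fun X => inf (range (f ^~ X))).
    apply: (@directed_inf_max_sublinear _ (exist _ s0 As0) f (fun X => - q (- X))).
    + exact: f_bounded.
    + move=> s s'; have [/asboolP ss'|/asboolP ss'] := Atot _ _ (svalP s) (svalP s').
        by exists s' => X; split; [exact: ss'|exact: lexx].
      by exists s => X; split; [exact: lexx|exact: ss'].
    + by move=> s; have [[]] := svalP (sval s).
    + by move=> s X Y; exists s; have [[_ + _] _] := svalP (sval s); exact.
    + by move=> s X n; exists s; have [[_ _ +] _] := svalP (sval s); exact.
  have inf_le s X : inf (range (f ^~ X)) <= f s X.
    by apply: ge_inf; [exists (- q (- X)) => _ [j _ <-] | exists s].
  have infq X : inf (range (f ^~ X)) <= q X.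
    apply: (le_trans (inf_le (exist _ s0 As0) X)).
    by have [_ +] := svalP s0; exact.
  pose P p := max_sublinear p /\ (forall X, p X <= q X).
  exists (exist P _ (conj infS infq)) => s As; apply/asboolP => X.
  exact: (inf_le (exist _ s As)).
- move=> [p [pS pq]] pmin; exists p => // p' p'S p'p.
  have p'q X : p' X <= q X by exact: le_trans (pq X).
  pose P p := max_sublinear p /\ (forall X, p X <= q X).
  apply/asboolP/(pmin (exist P p' (conj p'S p'q))).
  by apply/asboolP.
Qed.

(* At a minimal p, slope_at p Y cannot be smaller than p, hence
   p (- Y) <= - p Y for every Y, and a subadditive odd map is additive. *)
Lemma max_additive_exists q Y : max_sublinear q ->
  exists phi : F -> K,
    [/\ forall X Z, phi (X ⊕ Z) = Num.max (phi X) (phi Z),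
        forall X Z, phi (X + Z) = phi X + phi Z,
        forall X, phi X <= q X & phi Y = q Y].
Proof.
(* Starting Zorn's lemma from [slope_at q Y] instead of [q] forces [p (- Y) <= - q Y], which becomes
   [q Y <= p Y] once [p] is odd. *)
move=> qS; have q'S := slope_at_max_sublinear Y qS.
have [p [pS pq'] pmin] := minimal_max_sublinear q'S.
have [pmax pD _] := pS.
have pq X : p X <= q X by apply: (le_trans (pq' X)); exact: slope_at_le.
have pN X : p (- X) = - p X.
  apply/le_anti/andP; split; last first.
    by rewrite lerNl; exact: max_sublinearN.
  apply: le_trans (slope_atN X pS).
  by apply: pmin; [exact: slope_at_max_sublinear|exact: slope_at_le].
exists p; split=> // [X Z|].
  apply/le_anti/andP; split; first exact: pD.
  have := pD (- X) (- Z); rewrite -opprD !pN -opprD lerN2; exact.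
apply/le_anti/andP; split; first exact: pq.
rewrite -lerN2 -pN; apply: (le_trans (pq' _)); exact: slope_atN.
Qed.

End MaxSublinear.

(** * Elementary properties of characters and of the supremum norm *)

Section Characters.
Variables (K : realType) (R : char1SemiRingType) (E : R).
Implicit Types (phi : spectrum K E) (X Y : R).

Lemma char_fun0 phi : phi 0 = 0.
Proof. by apply: (addrI (phi 0)); rewrite -char_add !addr0. Qed.

Lemma char_funMn phi X n : phi (X *+ n) = phi X *+ n.
Proof.
elim: n => [|n IH]; first by rewrite !mulr0n char_fun0.
by rewrite !mulrS char_add IH.
Qed.

Lemma char_fun_le phi X Y : X ≼ Y -> phi X <= phi Y.
Proof. by rewrite /char1_le => XY; rewrite -XY char_oplus le_max lexx. Qed.

End Characters.

Lemma char_funN (K : realType) (F : char1SemiFieldType) (E : F)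
  (phi : spectrum K E) X : phi (- X) = - phi X.
Proof. by apply: (addrI (phi X)); rewrite -char_add !subrr char_fun0. Qed.

(** Attainment is asked only for positive [c]: 0 always belongs to the set whose supremum is taken,
    which covers an empty [S]. *)
Lemma sup_norm_attained (K : realType) (S : Type) (f : S -> K) (c : K) :
  0 <= c -> (forall s, `|f s| <= c) -> (0 < c -> exists s, `|f s| = c) ->
  c%:E = sup_norm f.
Proof.
move=> c0 fc cf; apply/le_anti/andP; split; last first.
  by apply: ge_ereal_sup => _ [->|[s _ <-]]; rewrite lee_fin.
apply: ereal_sup_ubound; move: c0; rewrite le_eqVlt => /orP[/eqP<-|/cf[s <-]].
  by left.
by right; exists s.
Qed.

(** * The radius as a supremum over characters *)

Section SemiFracCharacters.
Variables (K : realType) (R : cancelChar1SemiRingType) (E : R).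
Hypotheses (perfectR : perfect R) (unitE : order_unit E).

Local Notation S := (spectrum K (to_semifrac E)).
Local Notation uE t := (to_semifrac (rat_act t E)).
Local Notation r := (@unit_radius K R E).

Lemma char_unit_rat_act (phi : spectrum K E) t :
  0 <= t -> phi (rat_act t E) = ratr t.
Proof.
move=> t0; have d0 : (`|denq t|%N)%:R != 0 :> K.
  by rewrite pnatr_eq0 absz_eq0 denq_eq0.
apply: (mulIf d0); rewrite mulr_natr -char_funMn rat_actP// char_funMn char_unit.
by rewrite -(ratr_nat K `|numq t|%N) -rat_nat_frac// rmorphM /= ratr_nat.
Qed.

Lemma restrict_oplus (phi : S) (X Y : R) :
  phi (to_semifrac (X ⊕ Y)) = Num.max (phi (to_semifrac X)) (phi (to_semifrac Y)).
Proof. by rewrite to_semifrac_oplus char_oplus. Qed.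

Lemma restrict_add (phi : S) (X Y : R) :
  phi (to_semifrac (X + Y)) = phi (to_semifrac X) + phi (to_semifrac Y).
Proof. by rewrite to_semifracD char_add. Qed.

Definition spectrum_restrict (phi : S) : spectrum K E :=
  Spectrum (restrict_oplus phi) (restrict_add phi) (char_unit phi).

Lemma char_unit_multiple (phi : S) t : 0 <= t -> phi (uE t) = ratr t.
Proof. exact: (char_unit_rat_act (spectrum_restrict phi)). Qed.

(** A character is monotone and sends [uE t] to [t], so every rational bound of [Z] bounds
    [phi Z]. *)
Lemma char_norm_le (phi : S) Z : `|phi Z| <= r Z.
Proof.
rewrite leNgt; apply/negP => /(unit_radius_lt perfectR unitE)[t [t0 + Zt]].
have [Zle NZle] := (bounded_byE E t Z).1 Zt.
rewrite ltNge => /negP; apply; rewrite ler_norml lerNl -char_funN.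
by rewrite -(char_unit_multiple phi (ltW t0)) !char_fun_le.
Qed.

(** The radius is monotone on nonnegative elements; it remains to compare positive parts: that of a
    join is the join, that of a sum is at most the sum, and [(X ⊕ 0) *+ n ≼ X *+ n ⊕ 0]. *)
Lemma pos_part_radius_max_sublinear : max_sublinear (fun Z => r (Z ⊕ 0)).
Proof.
split=> [X Y|X Y|X n] /=.
- rewrite (_ : X ⊕ Y ⊕ 0 = (X ⊕ 0) ⊕ (Y ⊕ 0)); last first.
    by rewrite -[RHS]oplusA [0 ⊕ _]oplusC -[Y ⊕ 0 ⊕ 0]oplusA oplusxx oplusA.
  apply/le_anti; rewrite unit_radius_oplus//= ge_max; apply/andP; split;
    apply: unit_radius_between => //; [exact: char1_le_joinr|exact: char1_le_joinl
      |exact: char1_le_joinr|exact: char1_le_joinr].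
- apply: le_trans (unit_radiusD K perfectR unitE _ _).
  apply: unit_radius_between => //; first exact: char1_le_joinr.
  apply: char1_join_le; first by apply: char1_leD; exact: char1_le_joinl.
  by rewrite -[X in X ≼ _]addr0; apply: char1_leD; exact: char1_le_joinr.
- rewrite -unit_radiusMn//; apply: unit_radius_between => //.
    rewrite -[X in X ≼ _](mul0rn _ n.+1); apply: char1_leMn.
    exact: char1_le_joinr.
  exact: char1_pos_partMn.
Qed.

(* The bound phi <= r (_ ⊕ 0) gives phi E <= 1; conversely Y <= t E for t close
   to r Y = phi Y forces phi E >= 1. *)
Lemma char_attains_radius Y : 0 ≼ Y -> 0 < r Y -> exists phi : S, phi Y = r Y.
Proof.
move=> Y0 rY; have [phi [phi_max phi_add phi_le phiY]] :=
  max_additive_exists Y pos_part_radius_max_sublinear.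
have pos_id (Z : semifrac R) : 0 ≼ Z -> Z ⊕ 0 = Z by rewrite /char1_le oplusC.
rewrite pos_id// in phiY.
have phi0 : phi 0 = 0 by apply: (addrI (phi 0)); rewrite -phi_add !addr0.
have phiMn Z n : phi (Z *+ n) = phi Z *+ n.
  by elim: n => [|n IH]; rewrite ?mulr0n// !mulrS phi_add IH.
have phiE : phi (to_semifrac E) = 1.
  apply/le_anti/andP; split.
    apply: (le_trans (phi_le _)); rewrite pos_id; first exact: unit_radius_unit_le1.
    exact: (order_unit_ge0 perfectR).
  (* Clearing the denominator of [t] replaces [uE t] by integer multiples of [E], on which the
     additive map [phi] can be computed. *)
  have key t : 0 < t -> bounded_by E t Y -> r Y <= ratr t * phi (to_semifrac E).
    move=> t0 /(bounded_byE E t Y).1[Yt _].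
    have d0 : (0 : K) < (`|denq t|%N)%:R by rewrite ltr0n absz_gt0 denq_eq0.
    rewrite -(ler_pM2r d0) mulrAC -[X in _ <= _ * X * _](ratr_nat K) -rmorphM /=.
    rewrite (rat_nat_frac (ltW t0)) ratr_nat mulr_natl mulr_natr.
    rewrite -phiMn -unit_multipleMden// -phiY -phiMn.
    have := char1_leMn `|denq t|%N Yt; rewrite /char1_le => <-.
    by rewrite phi_max le_max lexx.
  rewrite leNgt; apply/negP => E1.
  (* The division by the value at [E] requires a positive one; if it is nonpositive, any bound of
     [Y] contradicts [0 < r Y]. *)
  have [E0|E0] := leP (phi (to_semifrac E)) 0.
    have [t [t0 /(key _ t0)]] := bounded_by_exists perfectR unitE Y.
    by apply/negP; rewrite -ltNge (le_lt_trans _ rY)// pmulr_rle0 ?ltr0q.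
  have : r Y < r Y / phi (to_semifrac E) by rewrite ltr_pdivlMr// gtr_pMr.
  move=> /(unit_radius_lt perfectR unitE)[t [t0 + /(key _ t0)]].
  by rewrite ltr_pdivlMr// leNgt => ->.
by exists (Spectrum phi_max phi_add phiE).
Qed.

(** Take a character attaining the radius of [Z ⊕ - Z]: its value there is the maximum of [phi Z]
    and [- phi Z]. *)
Lemma char_attains_norm Z : 0 < r Z -> exists phi : S, `|phi Z| = r Z.
Proof.
move=> rZ; have rabs := unit_radius_abs K perfectR unitE Z.
have [phi phiZ] := char_attains_radius (char1_abs_ge0 Z) (lt_le_trans rZ rabs).
exists phi; apply/le_anti; rewrite char_norm_le/= (le_trans rabs)// -phiZ.
by rewrite char_oplus char_funN ge_max ler_norm -normrN ler_norm.
Qed.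

Lemma unit_radius_sup_norm Z : (r Z)%:E = sup_norm (fun phi : S => phi Z).
Proof.
apply: sup_norm_attained; first exact: unit_radius_ge0.
- by move=> phi; exact: char_norm_le.
- exact: char_attains_norm.
Qed.

Hypothesis coneR : is_positive_cone R.

(** The embedding reflects the order, so the bounds on [X] hold inside [R], where characters of [R]
    respect them. The supremum is attained at the restriction of a character of the semi-field. *)
Lemma unit_radius_sup_norm_semiring (X : R) :
  (r (to_semifrac X))%:E = sup_norm (fun phi : spectrum K E => phi X).
Proof.
apply: sup_norm_attained; first exact: unit_radius_ge0.
- move=> phi; rewrite leNgt; apply/negP.
  move=> /(unit_radius_lt perfectR unitE)[t [t0 + Xt]].
  have [/to_semifrac_le Xle _] := (bounded_byE E t _).1 Xt.
  have X0 : 0 ≼ X.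
    by apply: to_semifrac_le; rewrite to_semifrac0; apply/coneR; exists X.
  rewrite ltNge => /negP; apply; rewrite ger0_norm.
    by rewrite -(char_unit_rat_act phi (ltW t0)) char_fun_le.
  by rewrite -(char_fun0 phi) char_fun_le.
- by move=> /char_attains_norm[phi phiX]; exists (spectrum_restrict phi).
Qed.

End SemiFracCharacters.

(** * Compactness and limits *)

(** If no [P i] were everything, the complements would generate a proper filter, and a cluster point
    of it contradicts the local hypothesis. *)
Lemma compact_directed_cover (T : topologicalType) (I : Type) (i0 : I)
  (P : I -> set T) : compact [set: T] ->
  (forall i j, exists k, P i `|` P j `<=` P k) ->
  (forall x : T, exists i, \forall y \near x, P i y) ->
  exists i, forall x, P i x.
Proof.
move=> cT Pdir Pnear; apply: contrapT => nP.
have PN i : ~` P i !=set0.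
  apply: contrapT => nx; apply: nP; exists i => x.
  by apply: contrapT => nPx; apply: nx; exists x.
have PF : ProperFilter (filter_from [set: I] (fun i => ~` P i)).
  apply: filter_from_proper => //; apply: filter_fromT_filter; first by exists i0.
  move=> i j; have [k Pk] := Pdir i j; exists k.
  by rewrite -setCU; exact: subsetC.
have [x [_ xcl]] := cT _ PF filterT.
have [i Pi] := Pnear x.
have nPi : filter_from [set: I] (fun i => ~` P i) (~` P i) by exists i.
by have [y []] := xcl _ _ nPi Pi.
Qed.

Lemma cvg_maxr (K : realType) (T : Type) (F : set_system T) (f g : T -> K)
  (a b : K) :
  Filter F -> f x @[x --> F] --> a -> g x @[x --> F] --> b ->
  Num.max (f x) (g x) @[x --> F] --> Num.max a b.
Proof.
move=> FF fa gb.
rewrite maxr_absE.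
rewrite (_ : (fun x => _) = fun x => (f x + g x + `|f x - g x|) / 2); last first.
  by apply/funext => x; rewrite maxr_absE.
apply: cvgMl; apply: cvgD; first exact: cvgD.
by apply: cvg_norm; exact: cvgB.
Qed.

(** The image filter has a cluster point in the segment, and an ultrafilter converges to its cluster
    points. *)
Lemma ultra_bounded_cvg (K : realType) (T : Type) (U : set_system T) (f : T -> K)
  (c : K) : UltraFilter U -> (forall x, `|f x| <= c) ->
  exists l : K, f x @[x --> U] --> l.
Proof.
move=> UU fc; have UP : ProperFilter U by exact: ultra_proper.
have fUc : U (f @^-1` `[- c, c]).
  by apply: filterE => x; rewrite /preimage /= in_itv /= -ler_norml.
have [l [_ lcl]] := @segment_compact K (- c) c (f @ U) _ fUc.
exists l => A lA; have [//|nA] := in_ultra_setVsetC (f @^-1` A) UU.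
by have [y [nAy Ay]] := lcl (~` A) A nA lA.
Qed.

Lemma spectrum_cvg (K : realType) (R : char1SemiRingType) (E : R)
  (U : set_system (spectrum K E)) (phi : spectrum K E) : Filter U ->
  (forall X, psi X @[psi --> U] --> phi X) -> U --> phi.
Proof.
move=> UF Uphi; apply/cvg_sup => X A.
move=> [B [[C Copen <-] Cphi] BA].
apply: filterS BA _; apply: (Uphi X).
exact: open_nbhs_nbhs.
Qed.

Lemma near_lt_add (K : realType) (T : topologicalType) (g h : T -> K) (e : K)
  (x : T) : continuous g -> continuous h -> g x < h x + e ->
  \forall y \near x, g y < h y + e.
Proof.
move=> gc hc; rewrite addrC -ltrBlDr => ghe.
have : g y - h y @[y --> x] --> g x - h x by apply: cvgB; [exact: gc|exact: hc].
by move=> /cvgr_lt/(_ _ ghe); apply: filterS => y; rewrite ltrBlDr addrC.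
Qed.

(** * Compactness of the spectrum and lattice Stone-Weierstrass approximation *)

Section Density.
Variables (K : realType) (R : cancelChar1SemiRingType) (E : R).
Hypotheses (perfectR : perfect R) (unitE : order_unit E).

Local Notation S := (spectrum K (to_semifrac E)).
Local Notation r := (@unit_radius K R E).

(** Along an ultrafilter the values at [X], bounded by [r X], converge, and the laws of a character
    pass to the limit. *)
Lemma spectrum_compact : compact [set: S].
Proof.
rewrite compact_ultra => U UU _.
have UP : ProperFilter U by exact: ultra_proper.
have /choice[l Ul] X : exists l : K, (psi : S) X @[psi --> U] --> l.
  apply: (ultra_bounded_cvg UU (c := r X)) => psi.
  exact: char_norm_le.
have lmax X Y : l (X ⊕ Y) = Num.max (l X) (l Y).
  apply: (cvg_unique (@Rhausdorff K) (Ul _)).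
  rewrite (_ : (fun _ => _) = fun psi : S => Num.max (psi X) (psi Y)).
    exact: cvg_maxr.
  by apply/funext => psi; rewrite char_oplus.
have ladd X Y : l (X + Y) = l X + l Y.
  apply: (cvg_unique (@Rhausdorff K) (Ul _)).
  rewrite (_ : (fun _ => _) = fun psi : S => psi X + psi Y).
    exact: cvgD.
  by apply/funext => psi; rewrite char_add.
have lE : l (to_semifrac E) = 1.
  apply: (cvg_unique (@Rhausdorff K) (Ul _)).
  rewrite (_ : (fun _ => _) = fun psi : S => 1); first exact: cvg_cst.
  by apply/funext => psi; rewrite char_unit.
by exists (Spectrum lmax ladd lE); split=> //; exact: spectrum_cvg.
Qed.

Lemma spectrum_ext (phi psi : S) : (forall X, phi X = psi X) -> phi = psi.
Proof.
case: phi psi => [f f1 f2 f3] [g g1 g2 g3] /= /funext fg.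
by case: _ / fg in g1 g2 g3 *; congr Spectrum; exact: Prop_irrelevance.
Qed.

Lemma rat_constant (t : rat) : exists Z : semifrac R, forall phi : S, phi Z = ratr t.
Proof.
have [t0|t0] := leP 0 t.
  by exists (to_semifrac (rat_act t E)) => phi; rewrite char_unit_multiple.
exists (- to_semifrac (rat_act (- t) E)) => phi.
by rewrite char_funN char_unit_multiple ?oppr_ge0 1?ltW// rmorphN opprK.
Qed.

Variable f : C0nonneg S K.

(* Only one-sided bounds are needed at the two points: if f phi < f psi, a large
   multiple of some W with phi W < 0 < psi W works because f >= 0. *)
Lemma two_point_approx (phi psi : S) (e : K) : 0 < e ->
  exists Z : semifrac R, phi Z <= f phi + e /\ f psi < psi Z + e.
Proof.
move=> e0; have [fle|flt] := leP (f psi) (f phi).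
  have /rat_in_itvoo[t] : f psi < f psi + e by rewrite ltrDl.
  rewrite in_itv /= => /andP[tlt tgt].
  have [Z Zt] := rat_constant t; exists Z; rewrite !Zt; split.
    by apply: (le_trans (ltW tgt)); rewrite lerD2r.
  by apply: (lt_trans tlt); rewrite ltrDl.
have [W phipsi] : exists W, phi W < psi W.
  apply: contrapT => nW; suff : phi = psi by move=> E'; rewrite E' ltxx in flt.
  apply: spectrum_ext => X.
  apply/le_anti/andP; split; rewrite leNgt; apply/negP => lt.
    by apply: nW; exists (- X); rewrite !char_funN ltrN2.
  by apply: nW; exists X.
have [t] := rat_in_itvoo phipsi; rewrite in_itv /= => /andP[phit tpsi].
have [B Bt] := rat_constant t.
have d0 : 0 < psi W - ratr t by rewrite subr_gt0.
pose n := Num.bound (f psi / (psi W - ratr t)).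
exists ((W - B) *+ n); rewrite !char_funMn !char_add !char_funN !Bt; split.
  apply: (@le_trans _ _ 0); last by rewrite addr_ge0 ?C0_ge0 ?ltW.
  by rewrite mulrn_wle0// subr_le0 ltW.
rewrite -[X in X < _]addr0; apply: ltrD => //.
rewrite -mulr_natl -ltr_pdivrMr//; apply: archi_boundP.
by rewrite divr_ge0 ?C0_ge0 ?ltW.
Qed.

(** Joins keep the bound at [phi] and enlarge the set where [f psi < psi Z + e]; these open sets
    cover the spectrum by the two-point case. *)
Lemma one_sided_approx (phi : S) (e : K) : 0 < e ->
  exists Z : semifrac R, phi Z <= f phi + e /\ forall psi, f psi < psi Z + e.
Proof.
move=> e0; pose I := {Z : semifrac R | phi Z <= f phi + e}.
have [Z0 [Z0phi _]] := two_point_approx phi phi e0.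
have [| |[Z Zphi] Zf] := @compact_directed_cover S I (exist _ Z0 Z0phi)
  (fun Z => [set psi : S | f psi < psi (sval Z) + e]) spectrum_compact.
- move=> [Z Zphi] [W Wphi].
  have ZW : phi (Z ⊕ W) <= f phi + e by rewrite char_oplus ge_max Zphi.
  exists (exist _ (Z ⊕ W) ZW) => psi /=.
  by rewrite char_oplus addr_maxl lt_max => -[->//|->]; rewrite orbT.
- move=> psi; have [Z [Zphi Zpsi]] := two_point_approx phi psi e0.
  exists (exist _ Z Zphi) => /=.
  apply: (@near_lt_add K S f (evaluation Z)) => //.
    exact: C0_continuous.
  exact: evaluation_continuous.
- by exists Z.
Qed.

Lemma uniform_approx (e : K) : 0 < e ->
  exists Z : semifrac R, forall phi : S, `|phi Z - f phi| <= e.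
Proof.
move=> e0.
pose I := {Z : semifrac R | forall psi : S, f psi < psi Z + e}.
have [Z0 Z0f] : exists Z : semifrac R, forall psi : S, f psi < psi Z + e.
  have [[phi _]|nS] := pselect (exists phi : S, True).
    by have [Z [_ Zf]] := one_sided_approx phi e0; exists Z.
  by exists 0 => psi; case: nS; exists psi.
have e20 : 0 < e / 2 by rewrite divr_gt0.
have [| |[Z Zlow] Zf] := @compact_directed_cover S I (exist _ Z0 Z0f)
  (fun Z => [set psi : S | psi (sval Z) < f psi + e]) spectrum_compact.
- move=> [Z Zf] [W Wf].
  (* The dual argument: [- (- Z ⊕ - W)] is the meet of [Z] and [W]. *)
  have ZW (psi : S) : f psi < psi (- (- Z ⊕ - W)) + e.
    rewrite char_funN char_oplus !char_funN oppr_max !opprK.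
    by rewrite addr_minl lt_min Zf Wf.
  exists (exist _ _ ZW) => psi /=.
  rewrite char_funN char_oplus !char_funN oppr_max !opprK gt_min.
  by move=> [->//|->]; rewrite orbT.
(* Using [e / 2] makes the bound at [psi] strict for [e], so that it persists nearby. *)
- move=> psi; have [Z [Zpsi Zf]] := one_sided_approx psi e20.
  have Zfe (phi : S) : f phi < phi Z + e.
    apply: (lt_trans (Zf phi)); rewrite ltrD2l.
    by rewrite ltr_pdivrMr// ltr_pMr// ltrDl.
  exists (exist _ Z Zfe) => /=.
  apply: (@near_lt_add K S (evaluation Z) f).
  - exact: evaluation_continuous.
  - exact: C0_continuous.
  - by apply: (le_lt_trans Zpsi); rewrite ltrD2l ltr_pdivrMr// ltr_pMr// ltrDl.
- exists Z => phi; rewrite ler_distl; apply/andP; split; last exact/ltW/Zf.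
  by rewrite lerBlDr; exact/ltW/Zlow.
Qed.

Lemma unit_radius_le_sup Z (c : K) :
  0 <= c -> (forall phi : S, `|phi Z| <= c) -> r Z <= c.
Proof.
move=> c0 Zc; rewrite leNgt; apply/negP => cZ.
have [phi phiZ] := char_attains_norm perfectR unitE (le_lt_trans c0 cZ).
by have := Zc phi; rewrite phiZ leNgt cZ.
Qed.

Hypothesis completeF : complete_dist (@semifrac_dist K R E).

(** Uniform approximants of [f] form a Cauchy sequence, since the radius is controlled by the values
    of characters; evaluation at the limit is [f] by [char_norm_le]. *)
Lemma evaluation_surjective :
  exists Z : semifrac R, forall phi : S, phi Z = f phi.
Proof.
have /choice[u uf] (n : nat) : exists Z : semifrac R, forall phi : S,
    `|phi Z - f phi| <= n.+1%:R^-1.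
  by apply: uniform_approx; rewrite invr_gt0.
have [|L uL] := completeF (u := u).
  (* Two errors of e/4 give a radius at most [e / 2], hence strictly below [e]. *)
  move=> e e0; have e20 : 0 < e / 2 / 2 by rewrite !divr_gt0.
  have [N _ Ne] := near_infty_natSinv_lt (PosNum e20).
  exists N => m n Nm Nn.
  apply: (@le_lt_trans _ _ (e / 2)); last by rewrite ltr_pdivrMr// ltr_pMr// ltrDl.
  apply: unit_radius_le_sup; first by rewrite divr_ge0 ?ltW.
  move=> phi; rewrite char_add char_funN -[phi (u m)](subrK (f phi)) -addrA.
  rewrite [e / 2]splitr; apply: (le_trans (ler_normD _ _)); apply: lerD.
    by apply: (le_trans (uf _ _)); apply/ltW/Ne.
  by rewrite distrC; apply: (le_trans (uf _ _)); apply/ltW/Ne.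
exists L => phi; apply/eqP; rewrite -subr_eq0 -normr_le0.
apply/ler_addgt0Pr => e e0; rewrite add0r.
have e20 : 0 < e / 2 by rewrite divr_gt0.
near \oo => n.
rewrite -[phi L](subrK (phi (u n))) -addrA [e]splitr.
apply: (le_trans (ler_normD _ _)); apply: lerD.
  rewrite distrC -char_funN -char_add.
  apply: (le_trans (char_norm_le perfectR unitE _ _)).
  apply: (le_trans (ler_norm _)); apply: ltW; near: n.
  exact: (cvgr0_norm_lt _ uL).
apply: (le_trans (uf _ _)); apply: ltW; near: n.
exact: near_infty_natSinv_lt (PosNum e20).
Unshelve. all: by end_near. Qed.

End Density.

(** * The Banach semi-field and the isometric isomorphism [Theta] *)

Unset Implicit Arguments.

Theorem theorem11 (K : realType) (R : cancelChar1SemiRingType) (E : R)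
    (perfectR : perfect R)
    (unitE : order_unit E)
    (unit_radius_eq0 : forall Z : semifrac R, unit_radius K E Z = 0 -> Z = 0)
    (banachR : banach (@semiring_dist K R E))
    (coneR : is_positive_cone R) :
  banach_semifield (@semifrac_dist K R E : semifrac R -> semifrac R -> K) /\
  [/\ semiring_iso (@Theta K R E coneR),
      forall X Y : R,
        (semiring_dist K E X Y)%:E =
        sup_dist (Theta K E coneR X) (Theta K E coneR Y) &
      forall X : R,
        (unit_radius K E (to_semifrac X))%:E =
        sup_norm (fun phi : spectrum K E => evaluation X phi)].
Proof.
have completeF := complete_semifrac_dist perfectR unitE banachR.2 coneR.
have isometry X Y : (semiring_dist K E X Y)%:E =
    sup_dist (Theta K E coneR X) (Theta K E coneR Y).
  rewrite /semiring_dist /semifrac_dist (unit_radius_sup_norm K perfectR unitE).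
  congr sup_norm; apply/funext => phi.
  by rewrite char_add char_funN.
(* Characters separate points, by definiteness of the radius. *)
have sub_eq0 (Z W : semifrac R) :
    (forall phi : spectrum K (to_semifrac E), phi Z = phi W) -> Z = W.
  move=> ZW; apply/eqP; rewrite -subr_eq0; apply/eqP/unit_radius_eq0/le_anti.
  rewrite unit_radius_ge0// andbT.
  apply: (unit_radius_le_sup perfectR unitE) => // phi.
  by rewrite char_add char_funN ZW subrr normr0.
split.
  by split=> //; exact: semifrac_dist_is_distance.
split=> //; last exact: unit_radius_sup_norm_semiring.
split.
- rewrite -setTT_bijective; split=> // [X Y _ _ XY|f _].
    apply: to_semifrac_inj; apply: sub_eq0 => phi.
    by have := congr1 (fun g : C0nonneg _ _ => g phi) XY.
  have [Z Zf] := evaluation_surjective perfectR unitE f completeF.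
  (* Since [f] is nonnegative, [0 ⊕ Z] and [Z] agree at every character; the cone hypothesis then
     places [Z] in [R]. *)
  have /coneR[X XZ] : 0 ≼ Z.
    rewrite /char1_le; apply: sub_eq0 => phi.
    by rewrite char_oplus char_fun0 Zf; apply/max_idPr/C0_ge0.
  by exists X => //; apply: C0P => phi; rewrite -Zf -XZ.
- by apply: C0P => phi; exact: char_fun0.
- by move=> X Y; apply: C0P => phi; exact: restrict_add.
- by move=> X Y; apply: C0P => phi; exact: restrict_oplus.
Qed.
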